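(* Let $\mathcal{K}\subseteq\mathbb{R}^d$ be a compact convex set with $d>e$ and assume that there is some $D\ge1$ such that $\|x\|_1\le D$ for all $x\in\mathcal{K}$. Set $$\beta=\frac1d,\qquad \eta=\sqrt{\frac{1}{\ln(D+1)+\ln d}},\qquad \alpha_t=\eta\sqrt{\sum_{s=1}^{t-1}\|g_s-h_s\|_\infty^2},$$ and $$\phi_t:\mathbb{R}^d\to\mathbb{R},\quad \phi_t(x)=\alpha_t\sum_{i=1}^d\Big((|x_i|+\beta)\ln\Big(\frac{|x_i|}{\beta}+1\Big)-|x_i|\Big).$$ Let $\{x_t\}$ be a sequence generated by the update rule (adaptive optimistic follow-the-regularised-leader) $$x_{t+1}\in\arg\min_{x\in\mathcal{K}}\ \Big\langle \sum_{s=1}^t g_s+h_{t+1},x\Big\rangle+\sum_{s=1}^{t+1}r_s(x)+\mathcal{B}_{\phi_{t+1}}(x,x_1),\qquad t\ge0,$$ where $g_t\in\partial l_t(x_t)$ and $\{h_t\}$ is a sequence of hint vectors; for $t=0$, since $\alpha_1=0$, this means $x_1\in\arg\min_{x\in\mathcal{K}}\langle h_1,x\rangle+r_1(x)$. Then $$\mathcal{R}_{1:T}\le c(d,D)\sqrt{\sum_{t=1}^T\|g_t-h_t\|_\infty^2}$$ for some $c(d,D)\in\mathcal{O}\big(D\sqrt{\ln(D+1)+\ln d}\big)$.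
   Context: Online composite convex optimisation over $T$ rounds: in round $t$ the player chooses $x_t\in\mathcal{K}$, then a convex function $l_t:\mathcal{K}\to\mathbb{R}$ is revealed and the player suffers $f_t(x_t)$, where $f_t=l_t+r_t$ and $r_t:\mathbb{R}^d\to\mathbb{R}_{\ge0}$ is a known closed convex function. The regret is $\mathcal{R}_{1:T}=\sum_{t=1}^T f_t(x_t)-\min_{x\in\mathcal{K}}\sum_{t=1}^T f_t(x)$. The subgradient set is $\partial l_t(y)=\{g\in\mathbb{R}^d : l_t(x)-l_t(y)\ge\langle g,x-y\rangle\ \forall x\in\mathcal{K}\}$. The hints $h_t\in\mathbb{R}^d$ are arbitrary vectors ($h_{t+1}$ is available when $x_{t+1}$ is chosen). $\mathcal{B}_\phi(x,y)=\phi(x)-\phi(y)-\langle\nabla\phi(y),x-y\rangle$ is the Bregman divergence. $\|\cdot\|_1$ is the $\ell_1$ norm and $\|\cdot\|_\infty$ the maximum norm. If the minimiser in the update is not unique, any minimiser may be taken. The quantity $c(d,D)$ depends only on $d$ and $D$; $c\in\mathcal{O}(h)$ means that there are absolute constants $C$, $D_0$, $d_0$ with $c(d,D)\le C\,h(d,D)$ for all $D\ge D_0$, $d\ge d_0$. *)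

(* Defs.v *)
From HB Require Import structures.
From mathcomp Require Import all_boot all_order all_algebra.
From mathcomp Require Import all_classical all_reals all_analysis.

Set Implicit Arguments.
Unset Strict Implicit.
Unset Printing Implicit Defensive.

Import Order.TTheory GRing.Theory Num.Theory.
Import numFieldNormedType.Exports.

Local Open Scope classical_set_scope.
Local Open Scope ring_scope.

(* R^d is 'rV[R]_d; the maximum norm of v is the library's norm `|v|
   (`mx_norm`), which is also the norm inducing the topology.  Rounds are
   numbered from 1: the values at 0 of the sequences l, r, x, g, h are unused. *)

Definition dot (R : realType) (d : nat) (u v : 'rV[R]_d) : R :=
  \sum_(i < d) u ord0 i * v ord0 i.

Definition norm1 (R : realType) (d : nat) (u : 'rV[R]_d) : R :=
  \sum_(i < d) `|u ord0 i|.

Definition gradient (R : realType) (d : nat) (phi : 'rV[R]_d -> R)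
    (y : 'rV[R]_d) : 'rV[R]_d :=
  \row_(i < d) 'D_(delta_mx ord0 i) (phi : 'rV[R]_d -> R^o) y.

Definition bregman (R : realType) (d : nat) (phi : 'rV[R]_d -> R)
    (x y : 'rV[R]_d) : R :=
  phi x - phi y - dot (gradient phi y) (x - y).

Definition subgradients (R : realType) (d : nat) (K : set 'rV[R]_d)
    (l : 'rV[R]_d -> R) (y : 'rV[R]_d) : set 'rV[R]_d :=
  [set g | forall x, K x -> l x - l y >= dot g (x - y)].

Definition argmin (R : realType) (d : nat) (K : set 'rV[R]_d)
    (F : 'rV[R]_d -> R) : set 'rV[R]_d :=
  [set x | K x /\ forall y, K y -> F x <= F y].

(* Closed in the sense of convex analysis: the epigraph is closed. *)
Definition closed_function (R : realType) (d : nat) (f : 'rV[R]_d -> R) : Prop :=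
  closed [set p : 'rV[R]_d * R | f p.1 <= p.2].

(* The minimum over K is written as an infimum, which is the same number whenever
   the minimum is attained; a convex l_t need not be lower semicontinuous on K. *)
Definition regret (R : realType) (d : nat) (K : set 'rV[R]_d)
    (f : nat -> 'rV[R]_d -> R) (x : nat -> 'rV[R]_d) (T : nat) : R :=
  \sum_(1 <= t < T.+1) f t (x t)
  - inf [set \sum_(1 <= t < T.+1) f t u | u in K].

Section regulariser.
Variables (R : realType) (d : nat) (D : R) (g h : nat -> 'rV[R]_d).

Definition beta : R := d%:R^-1.

Definition eta : R := Num.sqrt (1 / (ln (D + 1) + ln d%:R)).

Definition alpha (t : nat) : R :=
  eta * Num.sqrt (\sum_(1 <= s < t) `|g s - h s| ^+ 2).

Definition phi (t : nat) (x : 'rV[R]_d) : R :=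
  alpha t * \sum_(i < d)
    ((`|x ord0 i| + beta) * ln (`|x ord0 i| / beta + 1) - `|x ord0 i|).

End regulariser.

Definition ao_ftrl (R : realType) (d : nat) (K : set 'rV[R]_d) (D : R) (T : nat)
    (r : nat -> 'rV[R]_d -> R) (g h x : nat -> 'rV[R]_d) : Prop :=
  forall t : nat, (t < T)%N ->
    argmin K
      (fun u => dot (\sum_(1 <= s < t.+1) g s + h t.+1) u
                + \sum_(1 <= s < t.+2) r s u
                + bregman (phi D g h t.+1) u (x 1%N))
      (x t.+1).

Definition bigO_dD (R : realType) (c b : nat -> R -> R) : Prop :=
  exists (C D0 : R) (d0 : nat), forall (d : nat) (D : R),
    (d0 <= d)%N -> D0 <= D -> c d D <= C * b d D.

(* Main.v *)
Require Import Defs.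
From HB Require Import structures.
From mathcomp Require Import all_boot all_order all_algebra.
From mathcomp Require Import all_classical all_reals all_analysis.
From mathcomp Require Import ring lra.

Import Order.TTheory GRing.Theory Num.Theory.
Import numFieldNormedType.Exports.

Local Open Scope classical_set_scope.
Local Open Scope ring_scope.

Set Implicit Arguments.
Unset Strict Implicit.
Unset Printing Implicit Defensive.

(** The regulariser is [alpha_t] times the sum over the coordinates of
    [f a = (|a| + b) ln (|a| / b + 1) - |a|], an even extension of the shifted
    entropy to the whole line, with derivative [sgn a * ln (|a| / b + 1)] and
    second derivative [1 / (|a| + b)].  As [b = 1 / d], the weights
    [|x_i| + b] add up to at most [D + 1] on K, so by Cauchy-Schwarz the sum of
    the [f x_i] is strongly convex for the l1 norm with a modulus of order
    [1 / D] ([sym_bregman_sum_ge]).  On the other hand its Bregman divergence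
    is at most [4 D L] on K, where [L = ln (D + 1) + ln d]
    ([sym_bregman_sum_le]).

    In follow-the-regularised-leader the point [x_t] minimises an objective that
    is strongly convex with modulus of order [alpha_t / D], so every other point
    u of K loses at least a multiple of [alpha_t |x_t - u|_1 ^ 2 / D]
    ([ao_ftrl_growth]).  Writing [delta_t] for the maximum norm of [g_t - h_t],
    comparing consecutive objectives bounds the linearised regret against u by
    [psi_T u], where [psi_t] is the Bregman divergence from [x_1] of the t-th
    regulariser, plus the sum over t of
      [delta_t n_t - const * alpha_t n_t ^ 2 / D], with [n_t = |x_t - x_{t+1}|_1]
    and [x_{T+1} = u] ([optimistic_ftrl_regret]).  Let [Q_t] be the square root
    of [delta_1 ^ 2 + ... + delta_t ^ 2].  Since [alpha_t = Q_{t-1} / sqrt L] and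
    [n_t <= 2 D], the t-th term is at most [24 D sqrt L (Q_t - Q_{t-1})]
    ([adaptive_step]): the quadratic part wins when [delta_t <= Q_{t-1}],
    and the diameter of K suffices otherwise.  The sum telescopes, and
    [psi_T u <= 4 D L Q_T / sqrt L], whence the bound [28 D sqrt L Q_T]. *)

(** * The symmetric entropy in one variable *)

Lemma ln_sub_le (R : realType) (a b : R) : 0 < a -> 0 < b -> ln a - ln b <= a / b - 1.
Proof.
move=> a0 b0; rewrite -ln_div ?posrE//.
have := @le_ln1Dx R (a / b - 1); rewrite addrCA subrr addr0; apply.
by rewrite ltrBDr addNr divr_gt0.
Qed.

(** The Bregman gap of [a ln a - a] is bounded below by the squared Hellinger distance
    [(sqrt a - sqrt b) ^ 2], because [ln (a / b)] is twice [ln (sqrt a / sqrt b)]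
    and [ln z >= 1 - 1 / z].  Clearing the square roots gives a bound with the
    same shape as the second-order term of Taylor's formula. *)
Lemma entropy_gap_ge (R : realType) (a b : R) : 0 < a -> 0 < b ->
  (a - b) ^+ 2 / (2 * (a + b)) <= a * (ln a - ln b) - a + b.
Proof.
move=> a0 b0; set p := Num.sqrt a; set q := Num.sqrt b.
have p0 : 0 < p by rewrite sqrtr_gt0.
have q0 : 0 < q by rewrite sqrtr_gt0.
have ap : a = p ^+ 2 by rewrite sqr_sqrtr// ltW.
have bq : b = q ^+ 2 by rewrite sqr_sqrtr// ltW.
rewrite ap bq !lnXn// -mulrnBl -mulr_natr.
have hln : p * (1 - q / p) <= p * (ln p - ln q).
  by rewrite ler_pM2l//; have := ln_sub_le q0 p0; lra.
have pq : p * (1 - q / p) = p - q by field; rewrite gt_eqF.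
rewrite pq in hln.
apply: (@le_trans _ _ ((p - q) ^+ 2)); last by nra.
rewrite ler_pdivrMr; last by nra.
rewrite subr_sqr exprMn ler_wpM2l ?sqr_ge0//.
by have := sqr_ge0 (p - q); nra.
Qed.

Definition sym_entropy (R : realType) (b a : R) : R :=
  (`|a| + b) * ln (`|a| / b + 1) - `|a|.

(** The value 0 at 0, coming from [Num.sg 0 = 0], is the derivative there: the
    kinks of the absolute values in [sym_entropy] cancel. *)
Definition sym_entropy' (R : realType) (b a : R) : R :=
  Num.sg a * ln (`|a| / b + 1).

Lemma sym_entropyN (R : realType) (b a : R) :
  sym_entropy b (- a) = sym_entropy b a.
Proof. by rewrite /sym_entropy normrN. Qed.

Lemma sym_entropy'N (R : realType) (b a : R) :
  sym_entropy' b (- a) = - sym_entropy' b a.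
Proof. by rewrite /sym_entropy' normrN sgrN mulNr. Qed.

Lemma ln_ratioD1 (R : realType) (b a : R) : 0 < b -> 0 <= a ->
  ln (a / b + 1) = ln (a + b) - ln b.
Proof.
move=> b0 a0; rewrite -ln_div ?posrE//; last by rewrite ltr_wpDl.
by congr ln; field; rewrite gt_eqF.
Qed.

Lemma sym_entropyE (R : realType) (b a : R) : 0 < b -> 0 <= a ->
  sym_entropy b a = (a + b) * (ln (a + b) - ln b) - a.
Proof. by move=> b0 a0; rewrite /sym_entropy ger0_norm// ln_ratioD1. Qed.

Lemma sym_entropy'E (R : realType) (b a : R) : 0 < b -> 0 <= a ->
  sym_entropy' b a = ln (a + b) - ln b.
Proof.
move=> b0; rewrite le0r => /orP[/eqP ->|a0].
  by rewrite /sym_entropy' sgr0 mul0r add0r subrr.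
by rewrite /sym_entropy' gtr0_sg// mul1r gtr0_norm// ln_ratioD1// ltW.
Qed.

Lemma sym_entropy'_ge0 (R : realType) (b a : R) : 0 < b -> 0 <= a ->
  0 <= sym_entropy' b a.
Proof.
by move=> b0 a0; rewrite sym_entropy'E// subr_ge0 ler_ln ?posrE// ?lerDr// ltr_wpDl.
Qed.

Lemma sym_entropy'0 (R : realType) (b : R) : sym_entropy' b 0 = 0.
Proof. by rewrite /sym_entropy' sgr0 mul0r. Qed.

(** For points of the same sign this is [entropy_gap_ge] at the shifted
    points.  For points of opposite signs, monotonicity of the derivative shows
    that the gap between x and y is at least the sum of the gaps from x to 0 and
    from 0 to y. *)
Lemma sym_entropy_strongly_convex (R : realType) (b x y : R) : 0 < b ->
  (x - y) ^+ 2 / (4 * (`|x| + `|y| + 2 * b))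
  <= sym_entropy b x - sym_entropy b y - sym_entropy' b y * (x - y).
Proof.
(* Both sides are unchanged when x and y change sign together. *)
move=> b0; wlog y0 : x y / 0 <= y.
  move=> H; have [|/ltW yn] := leP 0 y; first exact: H.
  have := H (- x) (- y); rewrite oppr_ge0 => /(_ yn).
  by rewrite -opprD !normrN !sym_entropyN sym_entropy'N sqrrN mulrNN.
(* The constant 2 here, against 4 in the statement, leaves room for
   (u + y) ^ 2 <= 2 (u ^ 2 + y ^ 2) in the case of opposite signs. *)
have same (u v : R) : 0 <= u -> 0 <= v ->
    (u - v) ^+ 2 / (2 * (u + v + 2 * b))
    <= sym_entropy b u - sym_entropy b v - sym_entropy' b v * (u - v).
  move=> u0 v0; have ub : 0 < u + b by lra.
  have vb : 0 < v + b by lra.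
  rewrite !sym_entropyE// sym_entropy'E//.
  have := entropy_gap_ge ub vb.
  have -> : u + b - (v + b) = u - v by ring.
  have -> : u + b + (v + b) = u + v + 2 * b by ring.
  move=> /le_trans; apply; rewrite le_eqVlt; apply/orP; left; apply/eqP; ring.
rewrite (ger0_norm y0); have [x0|x0] := leP 0 x.
  apply: le_trans (same _ _ x0 y0); rewrite (ger0_norm x0).
  apply: ler_wpM2l; rewrite ?sqr_ge0// lef_pV2 ?posrE; nra.
rewrite (ltr0_norm x0).
have nx0 : 0 <= - x by lra.
have := same _ _ nx0 (lexx 0); have := same _ _ (lexx 0) y0.
rewrite sym_entropyN sym_entropy'0 !subr0 !mul0r !sub0r sqrrN !add0r addr0.
have s0 : 0 <= sym_entropy' b y * (- x).
  by rewrite mulr_ge0// sym_entropy'_ge0.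
set u := - x in nx0 s0 *; have -> : x = - u by rewrite opprK.
have dec (v w : R) : 0 <= v -> 0 <= w ->
    v ^+ 2 / (2 * (v + w + 2 * b)) <= v ^+ 2 / (2 * (v + 2 * b)).
  by move=> v0 w0; apply: ler_wpM2l; rewrite ?sqr_ge0// lef_pV2 ?posrE; nra.
have := dec _ _ nx0 y0; have := dec _ _ y0 nx0; rewrite (addrC y u).
rewrite -/u.
have mid : (- u - y) ^+ 2 / (4 * (u + y + 2 * b)) <=
   u ^+ 2 / (2 * (u + y + 2 * b)) + y ^+ 2 / (2 * (u + y + 2 * b)).
  have w0 : 0 < u + y + 2 * b by lra.
  rewrite -mulrDl ler_pdivrMr; last by lra.
  have -> : (u ^+ 2 + y ^+ 2) / (2 * (u + y + 2 * b)) * (4 * (u + y + 2 * b))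
    = 2 * (u ^+ 2 + y ^+ 2) by field; rewrite gt_eqF.
  have := sqr_ge0 (u - y); nra.
move=> *; nra.
Qed.

(** The derivative has slope [1 / (|a| + b) <= 1 / b]. *)
Lemma sym_entropy'_lipschitz (R : realType) (b x y : R) : 0 < b ->
  (sym_entropy' b x - sym_entropy' b y) * (x - y) <= (x - y) ^+ 2 / b.
Proof.
move=> b0.
wlog xy : x y / y <= x.
  move=> H; have [/H//|/ltW/H] := leP y x.
  by rewrite -mulrNN !opprB -(opprB x y) sqrrN.
rewrite expr2 -mulrA [leRHS]mulrC; apply: ler_wpM2r; first by rewrite subr_ge0.
have same (u v : R) : 0 <= v -> v <= u ->
    sym_entropy' b u - sym_entropy' b v <= (u - v) / b.
  move=> v0 vu; have u0 := le_trans v0 vu.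
  rewrite !sym_entropy'E// opprB addrA subrK.
  apply: le_trans (ln_sub_le _ _) _; [lra|lra|].
  rewrite lerBlDr ler_pdivrMr; last by lra.
  have -> : u + b = (u - v) + (v + b) by ring.
  rewrite mulrDl mul1r lerD2r.
  have := divr_ge0 (_ : 0 <= u - v) (ltW b0); rewrite subr_ge0 => /(_ vu) w0.
  rewrite mulrDr divfK ?gt_eqF// lerDr mulr_ge0//.
have [y0|y0] := leP 0 y; first exact: same.
have [x0|x0] := leP 0 x.
  have := same _ _ (lexx 0) x0.
  have := same _ _ (lexx 0) (ltW (_ : 0 < - y)); rewrite oppr_gt0 => /(_ y0).
  rewrite sym_entropy'0 sym_entropy'N !subr0 mulrBl mulNr; lra.
have := same (- y) (- x); rewrite oppr_ge0 lerN2 => /(_ (ltW x0) xy).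
by rewrite !sym_entropy'N !opprK addrC (addrC (- y)).
Qed.

(** * The regulariser and its Bregman divergence *)

Definition sym_bregman (R : realType) (b x y : R) : R :=
  sym_entropy b x - sym_entropy b y - sym_entropy' b y * (x - y).

Lemma sym_bregman_ge0 (R : realType) (b x y : R) : 0 < b -> 0 <= sym_bregman b x y.
Proof.
move=> b0; apply: le_trans (sym_entropy_strongly_convex x y b0).
rewrite divr_ge0 ?sqr_ge0// mulr_ge0// !addr_ge0// mulr_ge0//; exact: ltW.
Qed.

Lemma sym_bregman_le_sqr (R : realType) (b x y : R) : 0 < b ->
  sym_bregman b x y <= (x - y) ^+ 2 / b.
Proof.
move=> b0; apply: le_trans (sym_entropy'_lipschitz x y b0).
by have := sym_bregman_ge0 y x b0; rewrite /sym_bregman; lra.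
Qed.

(** The error of the difference quotient is [sym_bregman b (y_i + k) y_i / k],
    which is at most [|k| / b] in absolute value; in this way the derivative at a
    zero coordinate, where the absolute value has a kink, needs no separate
    treatment. *)
Lemma derive_sym_entropy_sum (R : realType) (d : nat) (a b : R) (y : 'rV[R]_d)
    (i : 'I_d) : 0 < b ->
  'D_(delta_mx ord0 i)
     ((fun u : 'rV[R]_d => a * \sum_(j < d) sym_entropy b (u ord0 j))
       : 'rV[R]_d -> R^o) y
  = a * sym_entropy' b (y ord0 i).
Proof.
move=> b0; rewrite /derive; apply: cvg_lim => //.
pose err (k : R) := k^-1 * sym_bregman b (k + y ord0 i) (y ord0 i).
have quotE (k : R) : k != 0 ->
    k^-1 *: (((fun u : 'rV[R]_d => a * \sum_(j < d) sym_entropy b (u ord0 j))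
       \o shift y) (k *: delta_mx ord0 i)
       - a * \sum_(j < d) sym_entropy b (y ord0 j))
    = a * (sym_entropy' b (y ord0 i) + err k).
  move=> k0 /=; rewrite -mulrBr -sumrB (bigD1 i)//= big1 ?addr0; last first.
    by move=> j ji; rewrite !mxE eqxx /= (negbTE ji) mulr0 add0r subrr.
  rewrite !mxE !eqxx mulr1 /err /sym_bregman addrK [LHS]/GRing.scale /=.
  by field.
rewrite -[X in _ --> X]addr0 -[X in _ --> _ + X](mulr0 a) -mulrDr.
apply: (@cvg_trans _ ((fun k => a * (sym_entropy' b (y ord0 i) + err k)) @ 0^')).
  apply: near_eq_cvg; near=> k; apply/esym/quotE.
  by near: k; exact: nbhs_dnbhs_neq.
apply: cvgMr; apply: cvgD; first exact: cvg_cst.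
apply/cvgr0Pnorm_le => e e0; near=> k.
have k0 : k != 0 by near: k; exact: nbhs_dnbhs_neq.
have nk : 0 < `|k| by rewrite normr_gt0.
rewrite /err normrM normfV ler_pdivrMl// ger0_norm ?sym_bregman_ge0//.
apply: le_trans (sym_bregman_le_sqr _ _ b0) _.
rewrite addrK -real_normK ?num_real// expr2 -mulrA ler_pM2l// ler_pdivrMr//.
near: k; apply: dnbhs0_le; exact: mulr_gt0.
Unshelve. all: by end_near.
Qed.

Definition sym_bregman_sum (R : realType) (d : nat) (b : R) (u y : 'rV[R]_d) : R :=
  \sum_(i < d) sym_bregman b (u ord0 i) (y ord0 i).

Lemma bregman_phi (R : realType) (d : nat) (D : R) (g h : nat -> 'rV[R]_d) (t : nat)
    (u y : 'rV[R]_d) : 0 < beta R d ->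
  bregman (phi D g h t) u y = alpha D g h t * sym_bregman_sum (beta R d) u y.
Proof.
move=> b0; rewrite /bregman /dot /gradient.
under eq_bigr => i _.
  rewrite mxE (derive_sym_entropy_sum (alpha D g h t) y i b0).
  rewrite mxE mxE -mulrA; over.
by rewrite -mulr_sumr -mulrBr -mulrBr -!sumrB.
Qed.

(** Titu's form of the Cauchy-Schwarz inequality, obtained by summing
    [2 l a <= a ^ 2 / w + l ^ 2 w] for the best slope [l]. *)
Lemma sqr_sum_div_le (R : realType) (d : nat) (a w : 'I_d -> R) (W : R) :
  (forall i, 0 < w i) -> \sum_(i < d) w i <= W -> 0 < W ->
  (\sum_(i < d) `|a i|) ^+ 2 / W <= \sum_(i < d) a i ^+ 2 / w i.
Proof.
move=> w0 wW W0; set n := \sum_(i < d) _; pose l := n / W.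
apply: (@le_trans _ _ (\sum_(i < d) (2 * l * `|a i| - l ^+ 2 * w i))); last first.
  apply: ler_sum => i _; rewrite ler_pdivlMr// -[leRHS]real_normK ?num_real//.
  have := sqr_ge0 (`|a i| - l * w i); nra.
rewrite sumrB -!mulr_sumr -/n.
have -> : n ^+ 2 / W = 2 * l * n - l ^+ 2 * W by rewrite /l; field; rewrite gt_eqF.
by rewrite lerB// ler_wpM2l// sqr_ge0.
Qed.

Lemma norm1_ge0 (R : realType) (d : nat) (u : 'rV[R]_d) : 0 <= norm1 u.
Proof. by apply: sumr_ge0 => i _. Qed.

Lemma norm1B_le (R : realType) (d : nat) (u v : 'rV[R]_d) :
  norm1 (u - v) <= norm1 u + norm1 v.
Proof.
rewrite /norm1 -big_split; apply: ler_sum => i _; rewrite !mxE.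
by apply: le_trans (ler_normD _ _) _; rewrite normrN.
Qed.

Lemma sym_bregman_sum_ge0 (R : realType) (d : nat) (b : R) (u y : 'rV[R]_d) :
  0 < b -> 0 <= sym_bregman_sum b u y.
Proof. by move=> b0; apply: sumr_ge0 => i _; exact: sym_bregman_ge0. Qed.

(** The denominators [|u_i| + |v_i| + 2 beta] add up to at most [2 D + 2]:
    choosing [beta = 1 / d] keeps this bound free of the dimension. *)
Lemma sym_bregman_sum_ge (R : realType) (d : nat) (D : R) (u v : 'rV[R]_d) :
  (0 < d)%N -> 0 <= D -> norm1 u <= D -> norm1 v <= D ->
  norm1 (u - v) ^+ 2 / (8 * (D + 1)) <= sym_bregman_sum (beta R d) u v.
Proof.
move=> d0 D0 uD vD.
have b0 : 0 < beta R d by rewrite invr_gt0 ltr0n.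
have bd : \sum_(i < d) beta R d = 1.
  by rewrite sumr_const card_ord -mulr_natr mulVf// pnatr_eq0 -lt0n.
apply: (@le_trans _ _ (\sum_(i < d) (u ord0 i - v ord0 i) ^+ 2 /
    (4 * (`|u ord0 i| + `|v ord0 i| + 2 * beta R d)))); last first.
  by apply: ler_sum => i _; exact: sym_entropy_strongly_convex.
have -> : norm1 (u - v) = \sum_(i < d) `|u ord0 i - v ord0 i|.
  by apply: eq_bigr => i _; rewrite !mxE.
apply: sqr_sum_div_le; last by lra.
- move=> i; rewrite mulr_gt0// ltr_wpDl ?addr_ge0// mulr_gt0//.
- rewrite -mulr_sumr !big_split /= -mulr_sumr bd -/(norm1 u) -/(norm1 v); lra.
Qed.

(** Strong convexity in midpoint form: it lets the growth of an objective around
    a constrained minimiser be read off from one comparison, without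
    differentiating the other terms of the objective. *)
Lemma sym_bregman_sum_midpoint (R : realType) (d : nat) (D : R)
    (u v m y : 'rV[R]_d) :
  (0 < d)%N -> 0 <= D -> norm1 u <= D -> norm1 v <= D -> norm1 m <= D ->
  m = 2^-1 *: (u + v) ->
  2 * sym_bregman_sum (beta R d) m y + norm1 (u - v) ^+ 2 / (16 * (D + 1))
  <= sym_bregman_sum (beta R d) u y + sym_bregman_sum (beta R d) v y.
Proof.
move=> d0 D0 uD vD mD mE.
(* The three-point identity; the linear terms at m cancel as m is the midpoint. *)
have -> : sym_bregman_sum (beta R d) u y + sym_bregman_sum (beta R d) v y
   = 2 * sym_bregman_sum (beta R d) m y
     + (sym_bregman_sum (beta R d) u m + sym_bregman_sum (beta R d) v m).
  rewrite /sym_bregman_sum mulr_sumr -!big_split /=; apply: eq_bigr => i _.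
  by rewrite /sym_bregman mE !mxE; field.
rewrite lerD2l.
have := sym_bregman_sum_ge d0 D0 uD mD; have := sym_bregman_sum_ge d0 D0 vD mD.
have half (w w' : 'rV[R]_d) : w - m = 2^-1 *: w' \/ w - m = - (2^-1 *: w') ->
    norm1 (w - m) = 2^-1 * norm1 w'.
  move=> H; rewrite /norm1 mulr_sumr; apply: eq_bigr => i _.
  by case: H => ->; rewrite !mxE ?normrN normrM gtr0_norm// invr_gt0.
rewrite (half u (u - v)); last first.
  by left; rewrite mE; apply/rowP => i; rewrite !mxE; field.
rewrite (half v (u - v)); last first.
  by right; rewrite mE; apply/rowP => i; rewrite !mxE; field.
set n := norm1 _ => h1 h2; apply: le_trans (lerD h2 h1).
rewrite le_eqVlt; apply/orP; left; apply/eqP; field; lra.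
Qed.

Lemma ln_ratio_le (R : realType) (d : nat) (D a : R) : (0 < d)%N -> 0 <= a -> a <= D ->
  0 <= ln (a / beta R d + 1) <= ln (D + 1) + ln d%:R.
Proof.
move=> d0 a0 aD; have d1 : 1 <= d%:R :> R by rewrite ler1n.
have a1 : 1 <= a / beta R d + 1.
  by rewrite lerDr divr_ge0// invr_ge0 ler0n.
rewrite ln_ge0//= -lnM ?posrE; [|lra|lra].
rewrite ler_ln ?posrE; [|lra|nra].
rewrite /beta invrK; nra.
Qed.

(** The divergence is at most [f u - f' y (u - y)] since f is nonnegative, and all
    the logarithms in it are at most [ln (D d + 1)]. *)
Lemma sym_bregman_sum_le (R : realType) (d : nat) (D : R) (u y : 'rV[R]_d) :
  (0 < d)%N -> 1 <= D -> norm1 u <= D -> norm1 y <= D ->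
  sym_bregman_sum (beta R d) u y <= 4 * D * (ln (D + 1) + ln d%:R).
Proof.
move=> d0 D1 uD yD; set b := beta R d; set L := ln _ + _.
have b0 : 0 < b by rewrite invr_gt0 ltr0n.
have bd : \sum_(i < d) b = 1.
  by rewrite sumr_const card_ord -mulr_natr mulVf// pnatr_eq0 -lt0n.
have coordD (w : 'rV[R]_d) (i : 'I_d) : norm1 w <= D -> `|w ord0 i| <= D.
  by apply: le_trans; rewrite /norm1 (bigD1 i)//= lerDl sumr_ge0.
have L0 : 0 <= L.
  have /andP[] := @ln_ratio_le R d D 0 d0 (lexx 0) (le_trans ler01 D1).
  exact: le_trans.
apply: (@le_trans _ _ (\sum_(i < d) (L * (`|u ord0 i| + b)
    + L * (`|u ord0 i| + `|y ord0 i|)))); last first.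
  rewrite big_split /= -!mulr_sumr !big_split /= bd -/(norm1 u) -/(norm1 y); nra.
apply: ler_sum => i _.
have /andP[lu0 luL] := ln_ratio_le d0 (normr_ge0 _) (coordD u i uD).
have /andP[ly0 lyL] := ln_ratio_le d0 (normr_ge0 _) (coordD y i yD).
have s0 : 0 <= sym_entropy b (y ord0 i).
  have := sym_bregman_ge0 (y ord0 i) 0 b0.
  have -> : sym_bregman b (y ord0 i) 0 = sym_entropy b (y ord0 i); last by [].
  rewrite /sym_bregman sym_entropy'0 [sym_entropy b 0]/sym_entropy normr0.
  by rewrite !mul0r !add0r ln1 mulr0 !subr0.
have su : sym_entropy b (u ord0 i) <= L * (`|u ord0 i| + b).
  rewrite /sym_entropy mulrC.
  have : ln (`|u ord0 i| / b + 1) * (`|u ord0 i| + b) <= L * (`|u ord0 i| + b).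
    by apply: ler_wpM2r => //; rewrite addr_ge0// ltW.
  by have := normr_ge0 (u ord0 i); lra.
have sl : - (sym_entropy' b (y ord0 i) * (u ord0 i - y ord0 i))
    <= L * (`|u ord0 i| + `|y ord0 i|).
  apply: le_trans (ler_norm _) _; rewrite normrN normrM; apply: ler_pM => //.
    rewrite /sym_entropy' normrM (ger0_norm ly0) -[L]mul1r; apply: ler_pM => //.
    by rewrite normr_sg lern1 leq_b1.
  exact: ler_normB.
rewrite /sym_bregman; lra.
Qed.

(** * Inner products and midpoints *)

Lemma dotDl (R : realType) (d : nat) (u v w : 'rV[R]_d) :
  dot (u + v) w = dot u w + dot v w.
Proof. by rewrite /dot -big_split; apply: eq_bigr => i _; rewrite mxE mulrDl. Qed.

Lemma dotDr (R : realType) (d : nat) (u v w : 'rV[R]_d) :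
  dot u (v + w) = dot u v + dot u w.
Proof. by rewrite /dot -big_split; apply: eq_bigr => i _; rewrite mxE mulrDr. Qed.

Lemma dotZr (R : realType) (d : nat) (a : R) (u v : 'rV[R]_d) :
  dot u (a *: v) = a * dot u v.
Proof. by rewrite /dot mulr_sumr; apply: eq_bigr => i _; rewrite mxE mulrCA. Qed.

Lemma dotNl (R : realType) (d : nat) (u v : 'rV[R]_d) : dot (- u) v = - dot u v.
Proof. by rewrite /dot -sumrN; apply: eq_bigr => i _; rewrite mxE mulNr. Qed.

Lemma dotNr (R : realType) (d : nat) (u v : 'rV[R]_d) : dot u (- v) = - dot u v.
Proof. by rewrite /dot -sumrN; apply: eq_bigr => i _; rewrite mxE mulrN. Qed.

Lemma dot_suml (R : realType) (d m n : nat) (g : nat -> 'rV[R]_d) (u : 'rV[R]_d) :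
  dot (\sum_(m <= t < n) g t) u = \sum_(m <= t < n) dot (g t) u.
Proof.
apply: (big_morph (fun v => dot v u)) => [v w|]; first exact: dotDl.
by rewrite /dot big1// => i _; rewrite mxE mul0r.
Qed.

Lemma dot_le_norm (R : realType) (d : nat) (u v : 'rV[R]_d) :
  dot u v <= `|u| * norm1 v.
Proof.
rewrite /dot /norm1 mulr_sumr; apply: ler_sum => i _.
apply: le_trans (ler_norm _) _; rewrite normrM ler_wpM2r//.
rewrite [leRHS]/Num.norm /= mx_normrE.
exact: (le_bigmax _ (fun ij : 'I_1 * 'I_d => `|u ij.1 ij.2|) (ord0, i)).
Qed.

Lemma half_in01 (R : realType) : (0 <= 2^-1 :> R) /\ (2^-1 <= 1 :> R).
Proof. by split; lra. Qed.

Definition half01 (R : realType) : {i01 R} :=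
  Itv01 (half_in01 R).1 (half_in01 R).2.

Lemma conv_half (R : realType) (M : lmodType R) (u v : convex_lmodType M) :
  conv (half01 R) u v = 2^-1 *: ((u : M) + v).
Proof.
rewrite /conv /= scalerDr; congr (_ *: _ + _ *: _).
by rewrite /unstable.onem /=; field.
Qed.

Lemma convex_set_midpoint (R : realType) (M : lmodType R) (K : set M) (u v : M) :
  convex_set (K : set (convex_lmodType M)) -> K u -> K v -> K (2^-1 *: (u + v)).
Proof.
move=> cK Ku Kv; have := cK u v (half01 R); rewrite conv_half => H.
by apply/set_mem/H; exact/mem_set.
Qed.

Lemma convex_function_midpoint (R : realType) (M : lmodType R) (f : M -> R) (u v : M) :
  convex_function setT (f : convex_lmodType M -> R^o) ->
  2 * f (2^-1 *: (u + v)) <= f u + f v.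
Proof.
move=> cf; have := cf (half01 R) u v (mem_set I) (mem_set I).
rewrite conv_half convRE /unstable.onem /= => H.
have {}H : f (2^-1 *: (u + v)) <= 2^-1 * f u + (1 - 2^-1) * f v by exact: H.
by lra.
Qed.

(** * Optimistic follow-the-regularised-leader *)

Definition ftrl_objective (R : realType) (d : nat) (r : nat -> 'rV[R]_d -> R)
    (g h : nat -> 'rV[R]_d) (psi : nat -> 'rV[R]_d -> R) (t : nat) (v : 'rV[R]_d) : R :=
  dot (\sum_(1 <= s < t.+1) g s + h t.+1) v + \sum_(1 <= s < t.+2) r s v
  + psi t.+1 v.

(** By induction on n, for all comparators u at once.  Taking [u = x_{n+1}] in the
    bound after n rounds turns its right-hand side into the objective minimised
    by [x_{n+1}], up to the hint; minimality transfers the bound to an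
    arbitrary u with the surplus [gain], and replacing the hint by the true
    [g_{n+1}] costs [dot (g - h) (x_{n+1} - u)], which [gain] and the increase of
    the potential [P] pay for. *)
Lemma optimistic_ftrl_regret (R : realType) (d : nat) (K : set 'rV[R]_d) (T : nat)
    (r : nat -> 'rV[R]_d -> R) (g h x : nat -> 'rV[R]_d)
    (psi gain : nat -> 'rV[R]_d -> R) (P : nat -> R) :
  P 0%N = 0 ->
  (forall u, K u -> 0 <= psi 0%N u) ->
  (forall t u, (t < T)%N -> K u -> psi t u <= psi t.+1 u) ->
  (forall t, (t < T)%N -> K (x t.+1)) ->
  (forall t u, (t < T)%N -> K u ->
    ftrl_objective r g h psi t (x t.+1) + gain t u
    <= ftrl_objective r g h psi t u) ->
  (forall t u, (t < T)%N -> K u ->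
    dot (g t.+1 - h t.+1) (x t.+1 - u) <= gain t u + (P t.+1 - P t)) ->
  forall n u, (n <= T)%N -> K u ->
    \sum_(1 <= t < n.+1) (dot (g t) (x t) + r t (x t))
    <= dot (\sum_(1 <= t < n.+1) g t) u + \sum_(1 <= t < n.+1) r t u
       + psi n u + P n.
Proof.
move=> P0 psi0 psiS Kx minx stepx; elim=> [|n IHn] u nT Ku.
  rewrite !big_geq// P0 !addr0; apply: addr_ge0; last exact: psi0.
  by rewrite /dot big1// => i _; rewrite mxE mul0r.
have Kxn := Kx n nT.
have := IHn (x n.+1) (ltnW nT) Kxn; have := psiS n _ nT Kxn.
have := minx n u nT Ku; have := stepx n u nT Ku.
rewrite /ftrl_objective !(@big_nat_recr _ _ _ n.+1)//= !dotDl !dotDr !dotNl !dotNr; lra.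
Qed.

(** The potential argument for the step size: p and q are the values of
    the square root of the accumulated squared errors after and before a round of
    error [delta], and [p - q = delta ^ 2 / (p + q)].  When [delta > q], this
    difference is at least [delta / 3] and n is bounded by the diameter.  When
    [delta <= q], it is at least [delta ^ 2 / (3 q)], and the maximum of
    [delta n - A n ^ 2] over n is [delta ^ 2 / (4 A)]. *)
Lemma adaptive_step (R : realType) (D s q p delta n : R) :
  1 <= D -> 1 <= s -> 0 <= q -> 0 <= p -> 0 <= delta -> 0 <= n <= 2 * D ->
  p ^+ 2 = q ^+ 2 + delta ^+ 2 ->
  delta * n <= s^-1 * q * (n ^+ 2 / (16 * (D + 1))) + 24 * D * s * (p - q).
Proof.
move=> D1 s1 q0 p0 de0 /andP[n0 n2D] pE.
have qp : q <= p by nra.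
have Ds : D <= D * s by rewrite ler_peMr//; lra.
have [deq|qde] := leP delta q; last first.
  have p2 : p <= 2 * delta by nra.
  have : delta <= 3 * (p - q) by nra.
  have : 0 <= s^-1 * q * (n ^+ 2 / (16 * (D + 1))).
    by rewrite !mulr_ge0// ?sqr_ge0// invr_ge0; lra.
  nra.
move: q0; rewrite le0r => /orP[/eqP q0|q0].
  have -> : delta = 0 by lra.
  by rewrite q0 mul0r mulr0 mul0r add0r subr0 !mulr_ge0//; lra.
have p2 : p <= 2 * q by nra.
have key : delta ^+ 2 <= 3 * q * (p - q) by nra.
set A := s^-1 * q / (16 * (D + 1)).
have A0 : 0 < A by rewrite /A !mulr_gt0// invr_gt0; lra.
have -> : s^-1 * q * (n ^+ 2 / (16 * (D + 1))) = A * n ^+ 2 by rewrite /A; ring.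
apply: (@le_trans _ _ (A * n ^+ 2 + delta ^+ 2 / (4 * A))).
  rewrite -subr_ge0.
  have -> : A * n ^+ 2 + delta ^+ 2 / (4 * A) - delta * n
     = A * (n - delta / (2 * A)) ^+ 2 by field; rewrite gt_eqF.
  by rewrite mulr_ge0 ?sqr_ge0// ltW.
rewrite lerD2l.
have -> : delta ^+ 2 / (4 * A) = 4 * s * (D + 1) * (delta ^+ 2 / q).
  by rewrite /A; field; do !(apply/andP; split); lra.
have {}key : delta ^+ 2 / q <= 3 * (p - q) by rewrite ler_pdivrMr//; lra.
(* D + 1 <= 2 D turns 4 * 3 * (D + 1) into the constant 24 * D. *)
apply: (@le_trans _ _ (4 * s * (D + 1) * (3 * (p - q)))).
  by rewrite ler_wpM2l// !mulr_ge0//; lra.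
have : 0 <= s * (p - q) by rewrite mulr_ge0//; lra.
nra.
Qed.

(** * The regret of the adaptive algorithm *)

Lemma regret_le (R : realType) (d : nat) (K : set 'rV[R]_d)
    (f : nat -> 'rV[R]_d -> R) (x : nat -> 'rV[R]_d) (T : nat) (E : R) :
  0 <= E -> (forall t, (t < T)%N -> K (x t.+1)) ->
  (forall u, K u ->
     \sum_(1 <= t < T.+1) f t (x t) - \sum_(1 <= t < T.+1) f t u <= E) ->
  regret K f x T <= E.
Proof.
move=> E0 Kx H; rewrite /regret.
have [[v Kv]|K0] := pselect (exists v, K v).
  rewrite lerBlDr -lerBlDl; apply: lb_le_inf.
    by exists (\sum_(1 <= t < T.+1) f t v), v.
  by move=> _ [u Ku <-]; have := H u Ku; lra.
(* Without a feasible point there is no round, and the infimum of the empty set is 0. *)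
case: T Kx H => [|T] Kx _; last by case: K0; exists (x 1%N); exact: (Kx 0%N).
have -> : K = set0 by rewrite -subset0 => u Ku; case: K0; exists u.
by rewrite image_set0 inf0 subr0 big_geq.
Qed.

Lemma linearised_regret_le (R : realType) (d : nat) (K : set 'rV[R]_d) (T : nat)
    (l r : nat -> 'rV[R]_d -> R) (g x : nat -> 'rV[R]_d) (u : 'rV[R]_d) :
  (forall t, (1 <= t <= T)%N -> subgradients K (l t) (x t) (g t)) -> K u ->
  \sum_(1 <= t < T.+1) (l t (x t) + r t (x t))
  - \sum_(1 <= t < T.+1) (l t u + r t u)
  <= \sum_(1 <= t < T.+1) (dot (g t) (x t) + r t (x t))
     - (dot (\sum_(1 <= t < T.+1) g t) u + \sum_(1 <= t < T.+1) r t u).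
Proof.
move=> hg Ku; rewrite dot_suml -big_split /= -!sumrB !big_nat.
apply: ler_sum => t tT; have := hg t tT u Ku; rewrite dotDr dotNr; lra.
Qed.

Lemma alpha_ge0 (R : realType) (d : nat) (D : R) (g h : nat -> 'rV[R]_d) (t : nat) :
  0 <= alpha D g h t.
Proof. by rewrite mulr_ge0 ?sqrtr_ge0. Qed.

Lemma alpha_le (R : realType) (d : nat) (D : R) (g h : nat -> 'rV[R]_d)
    (m n : nat) : (m <= n)%N -> alpha D g h m <= alpha D g h n.
Proof.
move=> mn; rewrite /alpha; apply: ler_wpM2l; first exact: sqrtr_ge0.
rewrite ler_wsqrtr//; have [m0|m0] := leqP m 1.
  by rewrite big_geq// sumr_ge0// => i _; exact: sqr_ge0.
by rewrite (big_cat_nat (ltnW m0) mn)/= lerDl sumr_ge0// => i _; exact: sqr_ge0.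
Qed.

Lemma alpha0 (R : realType) (d : nat) (D : R) (g h : nat -> 'rV[R]_d) :
  alpha D g h 0 = 0.
Proof. by rewrite /alpha big_geq// sqrtr0 mulr0. Qed.

Lemma etaE (R : realType) (d : nat) (D : R) : 0 <= ln (D + 1) + ln d%:R ->
  Defs.eta d D = (Num.sqrt (ln (D + 1) + ln d%:R))^-1.
Proof. by move=> L0; rewrite /Defs.eta div1r sqrtrV. Qed.

(** Compare [x_{t+1}] with the midpoint m of [x_{t+1}] and u, which is feasible:
    [F x_{t+1} <= F m], while strong convexity puts [2 F m] below
    [F x_{t+1} + F u] by the stated amount. *)
Lemma ao_ftrl_growth (R : realType) (d : nat) (K : set 'rV[R]_d) (D : R) (T : nat)
    (r : nat -> 'rV[R]_d -> R) (g h x : nat -> 'rV[R]_d) (t : nat) (u : 'rV[R]_d) :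
  (0 < d)%N -> convex_set (K : set (convex_lmodType 'rV[R]_d)) -> 0 <= D ->
  (forall v, K v -> norm1 v <= D) ->
  (forall s, (1 <= s <= T)%N ->
     convex_function setT (r s : convex_lmodType 'rV[R]_d -> R^o)) ->
  ao_ftrl K D T r g h x -> (t < T)%N -> K u ->
  let F := ftrl_objective r g h (fun s v => bregman (phi D g h s) v (x 1%N)) t in
  F (x t.+1) + alpha D g h t.+1 * (norm1 (x t.+1 - u) ^+ 2 / (16 * (D + 1))) <= F u.
Proof.
move=> d0 cK D0 KD cr hx tT Ku /=; set F := ftrl_objective _ _ _ _ _.
have [Kx xmin] := hx t tT.
have b0 : 0 < beta R d by rewrite invr_gt0 ltr0n.
pose m := 2^-1 *: (x t.+1 + u); have Km : K m by exact: convex_set_midpoint.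
have Fm : F (x t.+1) <= F m by exact: xmin.
suff : 2 * F m + alpha D g h t.+1 * (norm1 (x t.+1 - u) ^+ 2 / (16 * (D + 1)))
    <= F (x t.+1) + F u by move: Fm; lra.
have rm : 2 * \sum_(1 <= s < t.+2) r s m
    <= \sum_(1 <= s < t.+2) r s (x t.+1) + \sum_(1 <= s < t.+2) r s u.
  rewrite mulr_sumr -big_split /= !big_nat; apply: ler_sum => s /andP[s1 st].
  apply: convex_function_midpoint; apply: cr.
  by rewrite s1 (leq_trans _ tT).
have := sym_bregman_sum_midpoint (x 1%N) d0 D0 (KD _ Kx) (KD _ Ku) (KD _ Km) erefl.
move=> /(ler_wpM2l (alpha_ge0 D g h t.+1)).
rewrite /F /ftrl_objective !bregman_phi// {1 2}/m dotZr dotDr !mulrDr; move: rm; lra.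
Qed.

(** Apply [optimistic_ftrl_regret] with the surplus given by strong convexity and
    the potential [24 D s Q_n]; the remaining [4 D s Q_T] is the divergence of
    the comparator from [x_1], where the factor [1 / s] of the step size turns
    [s ^ 2 = ln (D + 1) + ln d] into [s]. *)
Lemma ao_ftrl_linear_regret (R : realType) (d : nat) (K : set 'rV[R]_d) (D : R)
    (T : nat) (r : nat -> 'rV[R]_d -> R) (g h x : nat -> 'rV[R]_d) (u : 'rV[R]_d) :
  (0 < d)%N -> convex_set (K : set (convex_lmodType 'rV[R]_d)) -> 1 <= D ->
  (forall v, K v -> norm1 v <= D) ->
  1 <= ln (D + 1) + ln d%:R ->
  (forall s, (1 <= s <= T)%N ->
     convex_function setT (r s : convex_lmodType 'rV[R]_d -> R^o)) ->
  ao_ftrl K D T r g h x -> K u ->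
  \sum_(1 <= t < T.+1) (dot (g t) (x t) + r t (x t))
    - (dot (\sum_(1 <= t < T.+1) g t) u + \sum_(1 <= t < T.+1) r t u)
  <= 28 * (D * Num.sqrt (ln (D + 1) + ln d%:R))
     * Num.sqrt (\sum_(1 <= t < T.+1) `|g t - h t| ^+ 2).
Proof.
move=> d0 cK D1 KD L1 cr hx Ku; have D0 : 0 <= D by lra.
have b0 : 0 < beta R d by rewrite invr_gt0 ltr0n.
have L0 : 0 <= ln (D + 1) + ln d%:R :> R by lra.
pose Q n := Num.sqrt (\sum_(1 <= t < n.+1) `|g t - h t| ^+ 2).
set s := Num.sqrt (ln _ + _); rewrite -/(Q T).
have s1 : 1 <= s by rewrite -sqrtr1 ler_wsqrtr.
have s2 : s ^+ 2 = ln (D + 1) + ln d%:R by rewrite sqr_sqrtr.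
have alphaE n : alpha D g h n.+1 = s^-1 * Q n by rewrite /alpha etaE.
have Kx t : (t < T)%N -> K (x t.+1) by move=> /hx[].
pose psi n v := bregman (phi D g h n) v (x 1%N).
have psiE n v : psi n v = alpha D g h n * sym_bregman_sum (beta R d) v (x 1%N).
  exact: bregman_phi.
have psiT : psi T u <= 4 * D * s * Q T.
  (* Without rounds x 1 need not lie in K, but then the regulariser vanishes. *)
  rewrite psiE; case: (posnP T) => [->|T0].
    by rewrite alpha0 mul0r !mulr_ge0 ?sqrtr_ge0//; lra.
  apply: (@le_trans _ _ (alpha D g h T.+1 * (4 * D * s ^+ 2))).
    apply: ler_pM; [exact: alpha_ge0|exact: sym_bregman_sum_ge0|exact: alpha_le|].
    by rewrite s2; apply: sym_bregman_sum_le => //; exact/KD/Ku || exact/KD/(Kx 0%N).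
  rewrite alphaE le_eqVlt; apply/orP; left; apply/eqP; field; lra.
have := @optimistic_ftrl_regret R d K T r g h x psi
  (fun t v => alpha D g h t.+1 * (norm1 (x t.+1 - v) ^+ 2 / (16 * (D + 1))))
  (fun n => 24 * D * s * Q n).
move=> /(_ _ _ _ Kx _ _ T u (leqnn T) Ku) H.
apply: le_trans (_ : _ <= psi T u + 24 * D * s * Q T) _.
  rewrite lerBlDl addrA; apply: H.
  - by rewrite /Q big_geq// sqrtr0 mulr0.
  - by move=> v Kv; rewrite psiE alpha0 mul0r.
  - move=> t v tT Kv; rewrite !psiE ler_wpM2r ?sym_bregman_sum_ge0//; exact: alpha_le.
  - by move=> t v tT Kv; exact: (ao_ftrl_growth d0 cK D0 KD cr hx).
  - move=> t v tT Kv; apply: le_trans (dot_le_norm _ _) _; rewrite alphaE -mulrBr.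
    apply: adaptive_step => //; rewrite ?sqrtr_ge0 ?norm1_ge0//=.
      by have := norm1B_le (x t.+1) v; have := KD _ Kv; have := KD _ (Kx t tT); lra.
    have sq n : Q n ^+ 2 = \sum_(1 <= t < n.+1) `|g t - h t| ^+ 2.
      by rewrite sqr_sqrtr// sumr_ge0// => i _; exact: sqr_ge0.
    by rewrite !sq big_nat_recr.
by move: psiT; lra.
Qed.

Theorem theorem2 (R : realType) :
  exists c : nat -> R -> R,
    bigO_dD c (fun (d : nat) (D : R) => D * Num.sqrt (ln (D + 1) + ln d%:R)) /\
    forall (d : nat) (K : set 'rV[R]_d) (D : R) (T : nat)
           (l r : nat -> 'rV[R]_d -> R) (g h x : nat -> 'rV[R]_d),
      expR 1 < d%:R :> R ->
      compact K ->
      convex_set K ->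
      1 <= D ->
      (forall u : 'rV[R]_d, K u -> norm1 u <= D) ->
      (forall t : nat, (1 <= t <= T)%N -> convex_function K (l t)) ->
      (forall t : nat, (1 <= t <= T)%N ->
         [/\ (forall u, 0 <= r t u), convex_function setT (r t)
           & closed_function (r t)]) ->
      (forall t : nat, (1 <= t <= T)%N -> subgradients K (l t) (x t) (g t)) ->
      ao_ftrl K D T r g h x ->
      regret K (fun t u => l t u + r t u) x T
        <= c d D * Num.sqrt (\sum_(1 <= t < T.+1) `|g t - h t| ^+ 2).
Proof.
exists (fun d D => 28 * (D * Num.sqrt (ln (D + 1) + ln d%:R))); split.
  by exists 28, 0, 0%N.
move=> d K D T l r g h x de _ cK D1 KD _ hr hg hx.
apply: (regret_le (E := 28 * (D * _) * _)).
- by rewrite !mulr_ge0// ?sqrtr_ge0//; lra.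
- by move=> t tT; case: (hx t tT).
move=> u Ku; have d0 : (0 < d)%N.
  by rewrite -(ltr0n R); apply: lt_trans de; exact: expR_gt0.
apply: le_trans (linearised_regret_le r hg Ku) _.
apply: (ao_ftrl_linear_regret d0 cK D1 KD _ _ hx Ku).
- rewrite -[leLHS]add0r lerD//; first by rewrite ln_ge0//; lra.
  by rewrite -[leLHS]expRK ler_ln ?posrE ?expR_gt0 ?ltr0n// ltW.
- by move=> t /hr[].
Qed.
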